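(* Let $n \geq 12$ and $2\leq s,t \leq n-2$ be integers such that $s+t>n$ and $s<t$. If $t=n-2$ or $t=n-3$, then there is no regular map of order $2^n$ with type $\{2^s, 2^t\}$.
   Context: A (finite) regular map $\mathcal{M}$ is identified with a finite group $G=\mathrm{Aut}(\mathcal{M})$ together with an ordered triple of distinguished generators $(\rho_0,\rho_1,\rho_2)$ of $G$ such that $\rho_0,\rho_1,\rho_2$ and $\rho_0\rho_2$ all have order exactly $2$. The order of the regular map is $|G|$ (the number of flags of the map). The map has type $\{m,l\}$ if $\rho_0\rho_1$ has order exactly $m$ (the face length) and $\rho_1\rho_2$ has order exactly $l$ (the vertex valency). *)

(* Defs.v *)
From mathcomp Require Import all_boot all_fingroup.

Set Implicit Arguments.
Unset Strict Implicit.
Unset Printing Implicit Defensive.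

Import GroupScope.

(* The automorphism group of the map, as a subgroup
   of an arbitrary ambient finite group type, with an ordered triple of
   distinguished generators.  No intersection condition is imposed. *)
Record regular_map := RegularMap {
  map_gT : finGroupType;
  map_aut : {group map_gT};
  rho0 : map_gT;
  rho1 : map_gT;
  rho2 : map_gT;
  map_gen : <<[set rho0; rho1; rho2]>> = map_aut;
  order_rho0 : #[rho0] = 2;
  order_rho1 : #[rho1] = 2;
  order_rho2 : #[rho2] = 2;
  order_rho02 : #[rho0 * rho2] = 2
}.

Definition map_order (M : regular_map) : nat := #|map_aut M|.

Definition map_has_type (M : regular_map) (m l : nat) : Prop :=
  #[rho0 M * rho1 M] = m /\ #[rho1 M * rho2 M] = l.

(* Main.v *)
Require Import Defs.
From mathcomp Require Import all_boot all_fingroup all_solvable.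
From mathcomp Require Import zify.

(** Write the generators as [a], [b], [c], put [r = b * c], and recall that [a]
commutes with [c].  The whole proof rests on the identity
[(a * b) ^+ 2 = r ^ a * r^-1] ([sqr_mul_involutions]): the order of the first
rotation [a * b] is governed by the way [a] conjugates the second rotation [r].

An involution acting on a cyclic 2-group acts on its squares as the identity or
as inversion ([involution_cyclic_2group]).  Hence, if [a] normalises [<[r]>],
then [(a * b) ^+ 4] is [1] or [r ^- 4]; the first forces [s <= 2], the second
[s = t].  The dihedral group [H] generated by [r] and [c] has order [2 ^ t.+1],
and every element of [H] outside [<[r]>] is an involution, so [a] normalises
[<[r]>] as soon as it normalises [H].  When [t = n - 2] this is automatic, [H]
having index 2.

When [t = n - 3], [H] has index 4.  If [a] does not normalise [H], then the
normaliser [K] of [H] lies strictly between [H] and the 2-group, with both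
indices equal to 2.  So [r ^ a] is in [K], which normalises [<[r]>], and its
square is in [H], hence in [<[r]>].  Now [a] acts on the cyclic group generated
by [r ^+ 2], and the same computation, one squaring later, shows that
[(a * b) ^+ 8] is [1] or [r ^- 8].  Thus [s <= 3] or [s = t].  In every case this
contradicts [s + t > n] or [s < t]. *)

Set Implicit Arguments.
Unset Strict Implicit.
Unset Printing Implicit Defensive.

Import GroupScope.

(** If [x ^ a = x ^+ k], then [k ^ 2 = 1] modulo [2 ^ u]; the 2-part of
[k ^ 2 - 1] is carried by one of the factors [k - 1] and [k + 1] up to a factor
2, which passing to squares absorbs. *)
Lemma involution_cyclic_2group (gT : finGroupType) (x a : gT) (u : nat) :
  #[x] = (2 ^ u)%N -> a ^+ 2 = 1 -> x ^ a \in <[x]> ->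
  (x ^ a) ^+ 2 = x ^+ 2 \/ (x ^ a) ^+ 2 = x ^- 2.
Proof.
move=> ox a2 /cycleP[k xa].
have xkk : x ^+ (k * k) == x ^+ 1.
  by rewrite expgM -xa -conjXg -xa -conjgM -(expg2 a) a2 conjg1.
rewrite eq_expg_mod_order ox in xkk.
have [l kE] : exists l, (k = l.*2.+1) \/ (k = l.*2 /\ u = 0).
  exists k./2; have [k_odd|k_even] := boolP (odd k); first by left; lia.
  right; split; first by lia.
  case: u {ox} xkk => // u; rewrite expnS => /eqP /(congr1 odd).
  by rewrite !odd_mod ?oddM //= (negPf k_even).
case: kE => [kE|[_ u0]]; last first.
  by move/eqP: ox; rewrite u0 order_eq1 => /eqP->; left; rewrite conj1g.
have dvd_u : 2 ^ u %| 4 * (l * l.+1).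
  move: xkk; rewrite eqn_mod_dvd; last by lia.
  by congr (_ %| _); lia.
have xaX : (x ^ a) ^+ 2 = x ^+ (4 * l) * x ^+ 2.
  by rewrite xa -expgM -expgD; congr (_ ^+ _); lia.
have [l_odd|l_even] := boolP (odd l).
- right; apply/eqP; rewrite xaX eq_sym eq_invg_mul -!expgD.
  rewrite -order_dvdn ox -(@Gauss_dvdr _ l) ?coprimeXl ?coprime2n //.
  by move: dvd_u; congr (_ %| _); lia.
- left; rewrite xaX; suff -> : x ^+ (4 * l) = 1 by rewrite mul1g.
  apply/eqP; rewrite -order_dvdn ox -(@Gauss_dvdr _ l.+1).
    by move: dvd_u; congr (_ %| _); lia.
  by rewrite coprimeXl // coprime2n /= l_even.
Qed.

Lemma sqr_mul_involutions (gT : finGroupType) (a b c : gT) :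
  a ^+ 2 = 1 -> b ^+ 2 = 1 -> c ^+ 2 = 1 -> commute a c ->
  (a * b) ^+ 2 = (b * c) ^ a * (b * c)^-1.
Proof.
move=> a2 b2 c2 ac.
have invE (z : gT) : z ^+ 2 = 1 -> z^-1 = z.
  by move=> z2; apply/eqP; rewrite eq_invg_mul -z2.
have aV := invE _ a2; have bV := invE _ b2; have cV := invE _ c2.
rewrite expg2 conjgE invMg aV bV cV -!mulgA.
by rewrite (mulgA c a) -ac -mulgA (mulgA c c) -expg2 c2 mul1g.
Qed.

(** Each squaring halves the order of a nontrivial 2-element, so the order can be
read off from a nontrivial iterated square; the bound [e < s] rules out the
first alternative. *)
Lemma eq_order_of_iterated_squares
    (gT : finGroupType) (x y : gT) (s t e : nat) :
  #[x] = (2 ^ s)%N -> #[y] = (2 ^ t)%N -> (e < s)%N ->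
  x ^+ (2 ^ e) = 1 \/ x ^+ (2 ^ e) = y ^- (2 ^ e) -> s = t.
Proof.
move=> ox oy lt_es xe.
have oxe := orderXexp e ox; have oye := orderXexp e oy.
case: xe => xe; rewrite xe in oxe; last rewrite orderV oye in oxe.
  have /eqP := oxe; rewrite order1 eq_sym -(expn0 2) eqn_exp2l //; lia.
by have /eqP := oxe; rewrite eqn_exp2l //; lia.
Qed.

(** With [r = b * c], the element [r ^ a] commutes with [r], so that
[(a * b) ^+ 4 = (r ^ a) ^+ 2 * r ^- 2], where [(r ^ a) ^+ 2] is [r ^+ 2] or
[r ^- 2]. *)
Lemma rotation_order_of_normal_cycle
    (gT : finGroupType) (a b c : gT) (s t : nat) :
  a ^+ 2 = 1 -> b ^+ 2 = 1 -> c ^+ 2 = 1 -> commute a c ->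
  #[a * b] = (2 ^ s)%N -> #[b * c] = (2 ^ t)%N -> (2 < s)%N ->
  (b * c) ^ a \in <[b * c]> -> s = t.
Proof.
move=> a2 b2 c2 ac os ot s_gt2 ra.
apply: (eq_order_of_iterated_squares os ot s_gt2).
have cra : commute ((b * c) ^ a) (b * c)^-1.
  by apply/commuteV/(centsP (cycle_abelian (b * c))); rewrite ?cycle_id.
have -> : (a * b) ^+ (2 ^ 2) = ((b * c) ^ a) ^+ 2 * (b * c) ^- 2.
  by rewrite (expgM _ 2 2) (sqr_mul_involutions a2 b2 c2 ac) expgMn // expgVn.
have [->|->] := involution_cyclic_2group ot a2 ra; first by left; rewrite mulgV.
by right; rewrite -invMg -expgD.
Qed.

(** When [a] stabilises only the squares, [q = r ^ a] need not commute with
[r = b * c].  However, [q] normalises [<[r]>], and [r ^+ 2] is a power of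
[q ^+ 2], so [q] centralises [r ^+ 2].  Hence [(q * r^-1) ^+ 2] is the product
of [q ^+ 2], [(r ^ q)^-1] and [r^-1], all in [<[r]>], and its square is
[q ^+ 4 * r ^- 4]. *)
Lemma rotation_order_of_normal_square
    (gT : finGroupType) (a b c : gT) (s t : nat) :
  a ^+ 2 = 1 -> b ^+ 2 = 1 -> c ^+ 2 = 1 -> commute a c ->
  #[a * b] = (2 ^ s)%N -> #[b * c] = (2 ^ t)%N -> (3 < s)%N ->
  (b * c) ^ a \in 'N(<[b * c]>) ->
  ((b * c) ^+ 2) ^ a \in <[(b * c) ^+ 2]> -> s = t.
Proof.
move=> a2 b2 c2 ac os ot s_gt3 nqr r2a.
apply: (eq_order_of_iterated_squares os ot s_gt3).
have ab8 : (a * b) ^+ (2 ^ 3) = ((b * c) ^ a * (b * c)^-1) ^+ 2 ^+ 2.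
  by rewrite -(sqr_mul_involutions a2 b2 c2 ac) -!expgM.
rewrite {}ab8; move: (b * c) ot nqr r2a => r ot nqr r2a.
have ot2 : #[r ^+ 2] = (2 ^ (t - 1))%N by rewrite -(orderXexp 1 ot).
have r4a := involution_cyclic_2group ot2 a2 r2a.
set q := r ^ a in nqr *.
have q2 : q ^+ 2 = (r ^+ 2) ^ a by rewrite conjXg.
rewrite -q2 in r2a r4a; clearbody q.
have r_q : r ^ q \in <[r]> by rewrite memJ_norm ?cycle_id.
have Rcomm y z : y \in <[r]> -> z \in <[r]> -> commute y z.
  by move=> yR zR; apply: (centsP (cycle_abelian r)).
have q2R : q ^+ 2 \in <[r]>.
  by apply: subsetP r2a; rewrite cycle_subG groupX ?cycle_id.
(* [q ^+ 2] generates the same group as [r ^+ 2], having the same order. *)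
have qr2 : (r ^ q) ^+ 2 = r ^+ 2.
  have : r ^+ 2 \in <[q ^+ 2]>.
    have /eqP-> : <[q ^+ 2]> == <[r ^+ 2]>.
      by rewrite eqEcard cycle_subG r2a -!orderE q2 orderJ leqnn.
    exact: cycle_id.
  case/cycleP=> m r2m; rewrite -conjXg r2m; apply/conjg_fixP/commgP.
  by apply/commute_sym/commuteX/commuteX.
have -> : (q * r^-1) ^+ 2 = q ^+ 2 * ((r ^ q)^-1 * r^-1).
  by rewrite -conjVg conjgE !expg2 !mulgA mulgK.
have rV : r^-1 \in <[r]> by rewrite groupV cycle_id.
have rqV : (r ^ q)^-1 \in <[r]> by rewrite groupV.
rewrite expgMn; last by apply: (Rcomm _ _ q2R); apply: groupM.
rewrite (expgMn 2 (Rcomm _ _ rqV rV)) !expgVn qr2 -invMg -expgD.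
case: r4a => ->; first by left; rewrite -expgM mulgV.
by right; rewrite -expgM -invMg -expgD.
Qed.

(** An element outside [<[r]>] has the form [x * c] with [x] in [<[r]>], and [c]
inverts [x]. *)
Lemma sqr_dihedral_reflection (gT : finGroupType) (r c g : gT) :
  c ^+ 2 = 1 -> r ^ c = r^-1 -> g \in <[r]> <*> <[c]> -> g \notin <[r]> ->
  g ^+ 2 = 1.
Proof.
move=> c2 rc; rewrite norm_joinEr; last first.
  by rewrite norms_cycle rc groupV cycle_id.
case/mulsgP=> x y xr /cycleP[m ->] ->.
rewrite -(odd_double_half m) -mul2n expgD (expgM _ 2) c2 expg1n mulg1.
case: (odd m) => /=; last by rewrite mulg1 xr.
have xc : x ^ c = x^-1 by case/cycleP: xr => k ->; rewrite conjXg rc expgVn.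
have cV : c^-1 = c by apply/eqP; rewrite eq_invg_mul -c2.
by rewrite conjgE cV in xc; rewrite !expg2 -!mulgA xc mulgV.
Qed.

Lemma card_dihedral (gT : finGroupType) (r c : gT) :
  #[c] = 2 -> r ^ c = r^-1 -> r ^+ 2 != 1 ->
  #|<[r]> <*> <[c]>| = (2 * #[r])%N.
Proof.
move=> oc rc r2; rewrite norm_joinEr; last first.
  by rewrite norms_cycle rc groupV cycle_id.
rewrite TI_cardMg -?orderE ?oc 1?mulnC //.
rewrite setIC; apply: prime_TIg; rewrite -?orderE ?oc // cycle_subG.
apply: contra r2 => cr.
have rcE : r ^ c = r.
  apply/conjg_fixP/commgP.
  by apply: (centsP (cycle_abelian r)); rewrite ?cycle_id.
by rewrite expg2 -eq_invg_mul -rc rcE.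
Qed.

(** Reflections being involutions, the rotation subgroup is determined by the
element orders: the conjugate of [r] lies in the dihedral group and is no
involution, hence it is a rotation. *)
Lemma dihedral_norm_cycle (gT : finGroupType) (r c x : gT) :
  c ^+ 2 = 1 -> r ^ c = r^-1 -> r ^+ 2 != 1 ->
  x \in 'N(<[r]> <*> <[c]>) -> r ^ x \in <[r]>.
Proof.
move=> c2 rc r2 nHx; apply: contraR r2 => rxN.
rewrite -(conjg_eq1 _ x) conjXg; apply/eqP.
apply: sqr_dihedral_reflection c2 rc _ rxN.
by rewrite memJ_norm // (subsetP (joing_subl _ _)) ?cycle_id.
Qed.

(** If [a] does not normalise [H], then [H] is a proper subgroup of its
normaliser [K], because 2-groups are nilpotent, and [K] is itself proper; both
indices are then 2, so that [K] is normal and squares of its elements lie in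
[H]. *)
Lemma conj_norm_of_index4 (gT : finGroupType) (G H : {group gT}) (a : gT) :
  2.-group G -> H \subset G -> #|G : H| = 4 -> a \in G -> a \notin 'N(H) ->
  forall h, h \in H -> h ^ a \in 'N(H) /\ (h ^ a) ^+ 2 \in H.
Proof.
move=> pG sHG iGH Ga aN h Hh.
have sKG : 'N_G(H) \subset G by apply: subsetIl.
have sHK : H \subset 'N_G(H) by rewrite subsetI sHG normG.
have prH : H \proper G.
  by rewrite properEcard sHG -(Lagrange sHG) iGH ltn_Pmulr.
have iKH : 1 < #|'N_G(H) : H|.
  have := nilpotent_proper_norm (pgroup_nil pG) prH.
  by rewrite indexg_gt1 properE => /andP[].
have iGK : 1 < #|G : 'N_G(H)|.
  by rewrite indexg_gt1; apply: contra aN => /subsetP/(_ a Ga)/setIP[].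
have iM := Lagrange_index sKG sHK; rewrite iGH in iM.
have {iKH iGK iM} [iKH iGK] : #|'N_G(H) : H| = 2 /\ #|G : 'N_G(H)| = 2.
  move: #|_ : H| #|G : _| iKH iGK iM => [|[|[|k]]] [|[|[|l]]] //=; lia.
have haK : h ^ a \in 'N_G(H).
  have nKG := normal_norm (index2_normal sKG iGK).
  by rewrite memJ_norm ?(subsetP sHK) ?(subsetP nKG).
have nHha : h ^ a \in 'N(H) by case/setIP: haK.
split=> //; rewrite coset_idr ?groupX // morphX //.
have <- : #|'N_G(H) / H| = 2 by rewrite card_quotient ?subsetIr.
by rewrite expg_cardG // mem_quotient.
Qed.

(** The lower bounds on [s] exclude [(a * b) ^+ 4 = 1] when the dihedral group
[<[b * c]> <*> <[c]>] has index 2, and also [(a * b) ^+ 8 = 1] when it has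
index 4 and need not be normal. *)
Lemma eq_rotation_order (gT : finGroupType) (G : {group gT}) (a b c : gT)
    (n s t : nat) :
  #|G| = (2 ^ n)%N -> a \in G -> b \in G -> c \in G ->
  a ^+ 2 = 1 -> b ^+ 2 = 1 -> #[c] = 2 -> commute a c ->
  #[a * b] = (2 ^ s)%N -> #[b * c] = (2 ^ t)%N -> 2 < t ->
  t.+2 = n /\ 2 < s \/ t.+3 = n /\ 3 < s -> s = t.
Proof.
move=> oG Ga Gb Gc a2 b2 oc cac os ot t_gt2 hn.
have c2 : c ^+ 2 = 1 by rewrite -oc expg_order.
have pG : 2.-group G by rewrite /pgroup [#|G|]oG pnatX.
have bV : b^-1 = b by apply/eqP; rewrite eq_invg_mul -expg2 b2.
have cV : c^-1 = c by apply/eqP; rewrite eq_invg_mul -expg2 c2.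
set r := b * c in ot.
have rc : r ^ c = r^-1.
  by rewrite conjgE invMg bV cV /r !mulgA -mulgA -expg2 c2 mulg1.
have rX e : e < t -> r ^+ (2 ^ e) != 1.
  move=> lt_et; rewrite -order_eq1 (orderXexp e ot) -(expn0 2) eqn_exp2l //.
  lia.
have r2 : r ^+ 2 != 1 by have := rX 1%N; rewrite expn1; apply; lia.
have r4 : (r ^+ 2) ^+ 2 != 1 by rewrite -expgM (rX 2).
pose H := <[r]> <*> <[c]>.
have sHG : H \subset G by rewrite join_subG !cycle_subG groupM.
have iGH : (#|G : H| * 2 ^ t.+1 = 2 ^ n)%N.
  by rewrite -oG -(Lagrange sHG) (card_dihedral oc rc r2) ot -expnS mulnC.
have {}iGH : #|G : H| = (2 ^ (n - t.+1))%N.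
  apply/eqP; rewrite -(eqn_pmul2r (expn_gt0 2 t.+1)) iGH -expnD subnK //; lia.
have normal_case : a \in 'N(H) -> s = t.
  move=> nHa.
  apply: (rotation_order_of_normal_cycle a2 b2 c2 cac os ot); first lia.
  exact: dihedral_norm_cycle nHa.
case: (boolP (a \in 'N(H))) => // nHa.
case: hn => -[hn s_gt].
  have iGH2 : #|G : H| = 2 by rewrite iGH -hn (_ : t.+2 - t.+1 = 1)%N //; lia.
  apply: normal_case.
  exact: subsetP (normal_norm (index2_normal sHG iGH2)) a Ga.
have iGH4 : #|G : H| = 4 by rewrite iGH -hn (_ : t.+3 - t.+1 = 2)%N //; lia.
have rH : r \in H by rewrite (subsetP (joing_subl _ _)) ?cycle_id.
have [nHra ra2H] := conj_norm_of_index4 pG sHG iGH4 Ga nHa rH.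
have ra2R : (r ^ a) ^+ 2 \in <[r]>.
  apply: contraR r4 => ra2N; rewrite -(conjg_eq1 _ a) !conjXg; apply/eqP.
  exact: sqr_dihedral_reflection c2 rc ra2H ra2N.
apply: (rotation_order_of_normal_square a2 b2 c2 cac os ot); first lia.
  rewrite -cycle_subG norms_cycle.
  exact: dihedral_norm_cycle nHra.
(* Both sides are subgroups of the same order in the cyclic group [<[r]>]. *)
have /eqP <- : <[(r ^+ 2) ^ a]> == <[r ^+ 2]>.
  rewrite (eq_subG_cyclic (cycle_cyclic r)) -?orderE ?orderJ // cycle_subG.
    by rewrite conjXg.
  by rewrite groupX ?cycle_id.
exact: cycle_id.
Qed.

Local Open Scope nat_scope.

Theorem theorem3p3 (n s t : nat)
  (hn : 12 <= n)
  (hs : 2 <= s <= n - 2)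
  (ht : 2 <= t <= n - 2)
  (hst : s + t > n)
  (hlt : s < t)
  (htn : t = n - 2 \/ t = n - 3) :
  ~ exists M : regular_map,
      map_order M = 2 ^ n /\ map_has_type M (2 ^ s) (2 ^ t).
Proof.
case=> -[gT G a b c genG oa ob oc oac] [/= oG [/= os ot]].
have sqr1 (z : gT) : #[z] = 2 -> (z ^+ 2)%g = 1%g.
  by move=> <-; apply: expg_order.
have cac : commute a c.
  have invE (z : gT) : #[z] = 2 -> (z^-1)%g = z.
    by move=> /sqr1 z2; apply/eqP; rewrite eq_invg_mul -expg2 z2.
  by rewrite /commute -[LHS](invE _ oac) invMg (invE _ oa) (invE _ oc).
have [Ga [Gb Gc]] : a \in G /\ b \in G /\ c \in G.
  by rewrite -genG; do ?split; apply: mem_gen; rewrite !inE eqxx ?orbT.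
suff: s = t by lia.
apply: (eq_rotation_order oG Ga Gb Gc (sqr1 _ oa) (sqr1 _ ob) oc cac os ot);
  lia.
Qed.
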